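(* Let $\alpha\in(0,1)$. If $F-G$ does not vanish everywhere on $\overline{\mathbb R}^m$, then $$\lim_{n\to\infty}P(\mathrm{KS}_n\ge c_{n;1-\alpha})=1 .$$ If $F-G$ does not vanish $G$-almost everywhere, then $$\lim_{n\to\infty}P(\mathrm{CvM}_n\ge d_{n;1-\alpha})=1 .$$
   Context: Conventions: $\overline{\mathbb R}^l=[-\infty,\infty]^l$ with its compact product topology; $\le$ on $\overline{\mathbb R}^l$ is componentwise; $\mathrm I(\cdot)$ is the indicator. A distribution function defined on $\overline{\mathbb R}^l$ is $x\mapsto P(\xi\le x)$, $x\in\overline{\mathbb R}^l$, for an $\mathbb R^l$-valued random vector $\xi$; $\int h(x)K(\mathrm dx)$ is integration with respect to the probability measure with distribution function $K$, and ''$K$-almost everywhere'' refers to this measure. Setting: Let $m\in\mathbb N$ and let $X_1,X_2,\dots$ be independent, not necessarily identically distributed $\mathbb R^m$-valued random vectors, $X_i$ having distribution function $F_i$ on $\overline{\mathbb R}^m$. There is a uniformly continuous distribution function $F$ on $\overline{\mathbb R}^m$ with $F_i\to F$ uniformly on $\overline{\mathbb R}^m$ as $i\to\infty$. For $n\in\mathbb N$, $G_n$ is a distribution function on $\overline{\mathbb R}^m$, and $G$ is a uniformly continuous distribution function on $\overline{\mathbb R}^m$ with $G_n\to G$ uniformly on $\overline{\mathbb R}^m$. The real weights $\alpha_{1,n},\dots,\alpha_{n,n}$ satisfy $\alpha_{i,n}\ge0$, $\sum_{i=1}^n\alpha_{i,n}=1$, $\lim_n\sqrt n\max_{1\le i\le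 n}\alpha_{i,n}=0$, $\lim_n n\sum_{i=1}^n\alpha_{i,n}^2=\kappa\in[1,\infty)$. Put, for $x\in\overline{\mathbb R}^m$, $\hat{\mathbb F}_n(x)=\sum_{i=1}^n\alpha_{i,n}\mathrm I(X_i\le x)$, and $$\mathrm{KS}_n=\sqrt n\sup_{x\in\overline{\mathbb R}^m}|\hat{\mathbb F}_n(x)-G_n(x)|,\qquad \mathrm{CvM}_n=n\int(\hat{\mathbb F}_n(x)-G_n(x))^2\,G_n(\mathrm dx).$$ Critical values: $c_{n;1-\alpha}$ (resp. $d_{n;1-\alpha}$) is the $(1-\alpha)$-quantile of the distribution that $\mathrm{KS}_n$ (resp. $\mathrm{CvM}_n$) has when $(F_1,\dots,F_n)=(G_n,\dots,G_n)$, i.e. when the observations $X_1,\dots,X_n$ in the statistic are replaced by independent random vectors each with distribution function $G_n$ (a $(1-\alpha)$-quantile of a real random variable $S$ being $\inf\{t:P(S\le t)\ge1-\alpha\}$). *)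

(* Defs.v *)
From HB Require Import structures.
From mathcomp Require Import all_boot all_order all_algebra finmap.
From mathcomp Require Import all_classical all_reals all_analysis.

Set Implicit Arguments.
Unset Strict Implicit.
Unset Printing Implicit Defensive.

Import Order.TTheory GRing.Theory Num.Theory.
Import numFieldNormedType.Exports.

Local Open Scope classical_set_scope.
Local Open Scope ring_scope.

(* R^m-valued random vectors take values in m.-tuple R, which carries the
   product sigma-algebra; points of [-oo, +oo]^m are row vectors over \bar R,
   whose uniform structure is the product one. *)

Definition ev_le (R : realType) (m : nat) (u v : 'rV[\bar R]_m) : bool :=
  [forall j, (u ord0 j <= v ord0 j)%E].

Definition ev_of (R : realType) (m : nat) (y : m.-tuple R) : 'rV[\bar R]_m :=
  \row_j (tnth y j)%:E.

(* x |-> P(xi <= x) on [-oo, +oo]^m, for xi an R^m-valued random vector of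
   law mu. *)
Definition df (R : realType) (m : nat) (mu : probability (m.-tuple R) R)
    (x : 'rV[\bar R]_m) : R :=
  fine (mu [set y | ev_le (ev_of y) x]).

Definition mutually_independent (R : realType) (d d' : measure_display)
    (T : measurableType d) (T' : measurableType d') (P : probability T R)
    (X : nat -> {RV P >-> T'}) : Prop :=
  forall (J : {fset nat}) (B : nat -> set T'),
    (forall i, measurable (B i)) ->
    P (\bigcap_(i in [set` J]) (X i @^-1` B i)) =
    (\prod_(i <- J) P (X i @^-1` B i))%E.

Section iid_law.
Context (d : measure_display) (T : measurableType d) (R : realType).

Definition tuple_cons (n : nat) (p : T * n.-tuple T) : n.+1.-tuple T :=
  [tuple of p.1 :: p.2].

Lemma measurable_tuple_cons (n : nat) :
  measurable_fun [set: T * n.-tuple T] (@tuple_cons n).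
Proof.
by apply: measurable_cons; [exact: measurable_fst|exact: measurable_snd].
Qed.

HB.instance Definition _ (n : nat) :=
  isMeasurableFun.Build _ _ _ _ (@tuple_cons n) (@measurable_tuple_cons n).

(* The n-fold product mu x ... x mu on n.-tuple T, i.e., the joint law of n
   independent random elements of law mu; see iid_lawE. *)
Fixpoint iid_law (mu : probability T R) (n : nat) : probability (n.-tuple T) R :=
  match n return probability (n.-tuple T) R with
  | 0 => \d_([tuple] : 0.-tuple T)
  | n'.+1 => distribution (mu \x iid_law mu n')%E (@tuple_cons n')
  end.

Lemma iid_lawE (mu : probability T R) (n : nat) (B : 'I_n -> set T) :
  (forall i, measurable (B i)) ->
  iid_law mu n [set y | forall i, B i (tnth y i)] = (\prod_(i < n) mu (B i))%E.
Proof.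
elim: n B => [|n IHn] B mB /=.
  by rewrite big_ord0 diracE mem_set// => -[].
rewrite big_ord_recl -(IHn (fun i => B (lift ord0 i))) //.
rewrite /distribution /pushforward.
have -> : @tuple_cons n @^-1` [set y | forall i, B i (tnth y i)] =
    B ord0 `*` [set y : n.-tuple T | forall i, B (lift ord0 i) (tnth y i)].
  apply/seteqP; split=> [[x y] /= H|[x y] /= [Hx Hy] i].
    split; first exact: (H ord0).
    by move=> i; have := H (lift ord0 i); rewrite tnthS.
  by case: (unliftP ord0 i) => [j ->|->] //; rewrite tnthS.
rewrite product_measure1E//.
rewrite (_ : [set y | _] = \bigcap_(i in [set: 'I_n])
    ((fun y : n.-tuple T => tnth y i) @^-1` B (lift ord0 i))); last first.
  by apply/seteqP; split=> [y H i _|y H i]; apply: H.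
apply: fin_bigcap_measurable => // i _.
by rewrite -[X in measurable X]setTI; exact: measurable_tnth.
Qed.

End iid_law.

Definition quantile (R : realType) (d : measure_display) (T : measurableType d)
    (P : probability T R) (S : T -> R) (p : R) : R :=
  inf [set t | (p%:E <= P [set w | (S w <= t)%R])%E].

Section statistics.
Context (R : realType) (m n : nat).
Implicit Types (w : 'I_n -> R) (xs : n.-tuple (m.-tuple R)).
Implicit Type nu : probability (m.-tuple R) R.

Definition wedf w xs (x : 'rV[\bar R]_m) : R :=
  \sum_(i < n) w i * (ev_le (ev_of (tnth xs i)) x)%:R.

Definition KS w (G : 'rV[\bar R]_m -> R) xs : R :=
  Num.sqrt n%:R * sup (range (fun x => `|wedf w xs x - G x|)).

(* The reference distribution function is df nu; nu is carried by R^m, so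
   the integral runs over R^m embedded in [-oo, +oo]^m. *)
Definition CvM w nu xs : R :=
  n%:R * (\int[nu]_y (wedf w xs (ev_of y) - df nu (ev_of y)) ^+ 2).

(* Critical values: quantiles of the statistics for an i.i.d. sample of law
   nu. *)
Definition KS_crit w nu (alpha : R) : R :=
  quantile (iid_law nu n) (KS w (df nu)) (1 - alpha).

Definition CvM_crit w nu (alpha : R) : R :=
  quantile (iid_law nu n) (CvM w nu) (1 - alpha).

End statistics.

(* Main.v *)
(* Both statistics have the form s_n U_n, where U_n is a distance between the
   weighted empirical distribution function and G_n. For every c > 0, the
   probability of U_n >= c under the null tends to 0, so the critical value is
   eventually at most s_n c; it then suffices that, for some c > 0, U_n exceeds
   c with probability tending to 1 under the alternative.

   All probability estimates come from the second moment bound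
   E (F^_n(x) - E F^_n(x))^2 <= sum_i alpha_{i,n}^2 -> 0, which needs pairwise
   independence only, together with Markov's inequality. For KS the supremum is
   reduced to finitely many points by a grid on which G has small increments.
   For CvM the bound is integrated over x; under the alternative some half-open
   box C of positive G-measure carries |F - G| >= eta, and the G_n-measure of C
   converges to its G-measure. *)

Require Import Defs.
From mathcomp Require Import all_boot all_order all_algebra finmap.
From mathcomp Require Import all_classical all_reals all_analysis.
From mathcomp Require Import measurable_realfun zify lra ring.

Set Implicit Arguments.
Unset Strict Implicit.
Unset Printing Implicit Defensive.

Import Order.TTheory GRing.Theory Num.Theory.
Import numFieldNormedType.Exports.

Local Open Scope classical_set_scope.
Local Open Scope ring_scope.

(** * Distribution functions on the extended space *)

Section df_basics.
Context (R : realType) (m : nat).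
Implicit Types (mu : probability (m.-tuple R) R) (x u v : 'rV[\bar R]_m).

Definition orthant x : set (m.-tuple R) := [set y | ev_le (ev_of y) x].

Lemma orthantE x :
  orthant x = [set y | forall j, ((tnth y j)%:E <= x ord0 j)%E].
Proof.
apply/seteqP; split => y /=; rewrite /ev_le.
  by move=> /forallP H j; have := H j; rewrite mxE.
by move=> H; apply/forallP => j; rewrite mxE.
Qed.

Lemma measurable_coord_le (j : 'I_m) (t : \bar R) :
  measurable [set y : m.-tuple R | ((tnth y j)%:E <= t)%E].
Proof.
rewrite -[X in measurable X]setTI.
apply: measurable_lee => //.
by apply/measurable_EFinP; exact: measurable_tnth.
Qed.

Lemma measurable_orthant x : measurable (orthant x).
Proof.
rewrite orthantE (_ : [set y | _] = \bigcap_(j in [set: 'I_m])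
    [set y : m.-tuple R | ((tnth y j)%:E <= x ord0 j)%E]); last first.
  by apply/seteqP; split=> [y H i _|y H i]; apply: H.
by apply: fin_bigcap_measurable => // i _; exact: measurable_coord_le.
Qed.

Lemma ev_leP u v : reflect (forall j, (u ord0 j <= v ord0 j)%E) (ev_le u v).
Proof. exact: forallP. Qed.

Lemma ev_le_trans u v x : ev_le u v -> ev_le v x -> ev_le u x.
Proof.
by move=> /ev_leP uv /ev_leP vx; apply/ev_leP => j; exact: le_trans (vx j).
Qed.

Lemma df_EFin mu x : (df mu x)%:E = mu (orthant x).
Proof. by rewrite /df fineK// fin_num_measure//; exact: measurable_orthant. Qed.

Lemma df_ge0 mu x : 0 <= df mu x.
Proof. by rewrite -lee_fin df_EFin. Qed.

Lemma df_le1 mu x : df mu x <= 1.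
Proof. by rewrite -lee_fin df_EFin probability_le1//; exact: measurable_orthant. Qed.

Lemma df_le mu u v : ev_le u v -> df mu u <= df mu v.
Proof.
move=> uv; rewrite -lee_fin !df_EFin le_measure ?inE//; [exact: measurable_orthant..|].
by move=> y /=; move/ev_le_trans; exact.
Qed.

(** The uniformity of [\bar R] is pulled back from [-1, 1] along [contract], so closeness of points
    is measured on that scale, coordinate by coordinate. *)
Lemma df_unif_continuous mu : unif_continuous (df mu) ->
  forall e : R, 0 < e -> exists2 dlt : R, 0 < dlt &
    forall u v, (forall j, `|contract (u ord0 j) - contract (v ord0 j)| < dlt) ->
      `|df mu u - df mu v| < e.
Proof.
move=> ucf e e0.
have /ucf : entourage [set xy : R * R | ball xy.1 e xy.2].
  by exists e.
rewrite /nbhs/= -entourage_ballE => -[dlt /= dlt0 sub].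
exists dlt => // u v uv; apply: (sub (u, v)).
by split=> // i j; rewrite (ord1 i); exact: uv.
Qed.

Lemma df_uniform_cvg (mu_ : nat -> probability (m.-tuple R) R) mu :
  {uniform, (fun n => df (mu_ n)) @ \oo --> df mu} ->
  forall e : R, 0 < e -> \forall n \near \oo, forall x,
    `|df (mu_ n) x - df mu x| < e.
Proof.
move=> ucf e e0.
have := ucf [set g | forall x, `|g x - df mu x| < e].
rewrite /nbhs/=; apply; apply/uniform_nbhs.
exists [set xy : R * R | ball xy.1 e xy.2]; split; first by exists e.
by move=> g H x; have := H x I; rewrite /ball /= distrC.
Qed.

End df_basics.

(** * Markov's inequality and the second moment of a weighted sum of indicators *)

Section second_moment.
Context d (T : measurableType d) (R : realType) (P : probability T R).

Lemma bounded_integrable (f : T -> R) (M : R) : measurable_fun setT f ->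
  (forall x, `|f x| <= M) -> P.-integrable setT (EFin \o f).
Proof.
move=> mf fM; apply: measurable_bounded_integrable => //.
  by rewrite (le_lt_trans (probability_le1 _ _))// ltry.
exists M; split; first exact: num_real.
by move=> N MN x _; exact: le_trans (fM x) (ltW MN).
Qed.

Lemma measurable_ge (f : T -> R) (r : R) : measurable_fun setT f ->
  measurable [set t | r <= f t].
Proof.
move=> mf; rewrite -[X in measurable X]setTI.
have := @measurable_lee _ _ _ setT measurableT (cst r%:E) (EFin \o f).
by apply => //; exact/measurable_EFinP.
Qed.

Lemma measurable_le (f : T -> R) (r : R) : measurable_fun setT f ->
  measurable [set t | f t <= r].
Proof.
move=> mf; rewrite -[X in measurable X]setTI.
have := @measurable_lee _ _ _ setT measurableT (EFin \o f) (cst r%:E).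
by apply => //; exact/measurable_EFinP.
Qed.

Lemma markov_bound (f : T -> R) (s e : R) : measurable_fun setT f ->
  (forall x, 0 <= f x) -> (\int[P]_x (f x)%:E <= s%:E)%E -> 0 < e ->
  (P [set x | (e <= f x)%R] <= (s / e)%:E)%E.
Proof.
move=> mf f0 fs e0.
have mEf : measurable_fun setT (EFin \o f) by exact/measurable_EFinP.
have := @le_integral_comp_abse _ _ _ P _ measurableT (EFin \o f) e id
  (@measurable_id _ _ setT) (fun _ => id) (fun _ _ _ _ => id) mEf e0.
rewrite setTI /= (_ : [set x | _] = [set x | e <= f x]); last first.
  by apply/seteqP; split => x /=; rewrite lee_fin ger0_norm.
under eq_integral do rewrite ger0_norm//.
by rewrite EFinM lee_pdivlMr// muleC => /le_trans; exact.
Qed.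

(** After expanding the square, pairwise independence cancels the off-diagonal terms, and the
    diagonal ones are w_i^2 p_i (1 - p_i) with p_i in [0, 1]. *)
Lemma second_moment n (A : 'I_n -> set T) (w : 'I_n -> R) :
  (forall i, measurable (A i)) ->
  (forall i j, i != j -> P (A i `&` A j) = (P (A i) * P (A j))%E) ->
  (\int[P]_x ((\sum_(i < n) w i * (\1_(A i) x - fine (P (A i)))) ^+ 2)%:E
    <= (\sum_(i < n) w i ^+ 2)%:E)%E.
Proof.
move=> mA indep.
pose p i := fine (P (A i)).
have pE i : P (A i) = (p i)%:E by rewrite fineK// fin_num_measure.
have p0 i : 0 <= p i by rewrite -lee_fin -pE.
have p1 i : p i <= 1 by rewrite -lee_fin -pE probability_le1.
have mI i : measurable_fun setT (\1_(A i) : T -> R) by exact: measurable_indic.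
have mII i j : measurable_fun setT (\1_(A i `&` A j) : T -> R).
  by apply: measurable_indic; exact: measurableI.
pose q i j := fine (P (A i `&` A j)).
have qE i j : P (A i `&` A j) = (q i j)%:E.
  by rewrite fineK// fin_num_measure//; exact: measurableI.
have ind01 (B : set T) x : 0 <= (\1_B x : R) <= 1.
  by rewrite indicE ler0n lern1 leq_b1.
pose Z i x : R := \1_(A i) x - p i.
have intZZ i j : (\int[P]_x (Z i x * Z j x)%:E = (q i j - p i * p j)%:E)%E.
  have intI (B : set T) : measurable B -> P.-integrable setT (EFin \o \1_B).
    exact: integrable_indic.
  have intc (r : R) : P.-integrable setT (EFin \o cst r).
    by apply: (@bounded_integrable _ `|r|).
  transitivity (\int[P]_x ((\1_(A i `&` A j) x)%:E - (p j)%:E * (\1_(A i) x)%:E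
     - (p i)%:E * (\1_(A j) x)%:E + (p i * p j)%:E))%E.
    apply: eq_integral => x _; rewrite -!EFinM -!EFinB -EFinD; congr EFin.
    by rewrite /Z indicI /=; ring.
  have i1 : P.-integrable setT (fun x => (\1_(A i `&` A j) x)%:E).
    by apply: intI; exact: measurableI.
  have i2 k l : P.-integrable setT (fun x => (p k)%:E * (\1_(A l) x)%:E)%E.
    by apply: integrableZl => //; exact: intI.
  have i3 : P.-integrable setT
     (fun x => (\1_(A i `&` A j) x)%:E - (p j)%:E * (\1_(A i) x)%:E)%E.
    exact: integrableB.
  have i4 : P.-integrable setT
     (fun x => (\1_(A i `&` A j) x)%:E - (p j)%:E * (\1_(A i) x)%:E
       - (p i)%:E * (\1_(A j) x)%:E)%E.
    exact: integrableB.
  rewrite integralD//; last exact: (intc (p i * p j)).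
  rewrite integralB// integralB// !integralZl//; [|exact: intI..].
  rewrite !integral_indic//; last exact: measurableI.
  rewrite !setIT integral_cst//.
  transitivity ((q i j)%:E - (p j)%:E * (p i)%:E - (p i)%:E * (p j)%:E +
      (p i * p j)%:E * 1)%E.
    congr (_ - _ * _ - _ * _ + _ * _)%E;
      [exact: qE|exact: pE|exact: pE|exact: probability_setT].
  by rewrite mule1 -!EFinM -!EFinB -EFinD; congr EFin; ring.
have ZM i x : `|Z i x| <= 1.
  rewrite /Z ler_norml; have /andP[a0 a1] := ind01 (A i) x.
  by have := p0 i; have := p1 i; lra.
under eq_integral.
  move=> x _; rewrite expr2 big_distrlr /=.
  rewrite (eq_bigr (fun i => \sum_(j < n) (w i * w j) * (Z i x * Z j x))); last first.
    by move=> i _; apply: eq_bigr => j _; rewrite /Z /p; ring.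
  rewrite -sumEFin; under eq_bigr do rewrite -sumEFin.
  over.
have mZ i : measurable_fun setT (Z i) by exact: measurable_funB.
have intw i j : P.-integrable setT (fun x => (w i * w j * (Z i x * Z j x))%:E).
  apply: (@bounded_integrable _ `|w i * w j|).
    by apply: measurable_funM => //; exact: measurable_funM.
  move=> x; rewrite normrM ler_piMr// normrM.
  by rewrite mulr_ile1.
rewrite integral_sum//; last first.
  by move=> i; exact: integrable_sum.
(* Row i of the double sum keeps only its diagonal entry, the variance of the indicator of [A i]
   times w_i^2. *)
have row i : (\int[P]_x (\sum_(j < n) (w i * w j * (Z i x * Z j x))%:E) =
   (w i ^+ 2 * (q i i - p i * p i))%:E)%E.
  rewrite integral_sum// (bigD1 i)//= big1 ?adde0.
    under eq_integral do rewrite EFinM.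
    rewrite integralZl//; first by rewrite intZZ -EFinM; congr EFin; ring.
    apply: (@bounded_integrable _ 1); first exact: measurable_funM.
    by move=> x; rewrite normrM mulr_ile1.
  move=> j ji; under eq_integral do rewrite EFinM.
  rewrite integralZl//; last first.
    apply: (@bounded_integrable _ 1); first exact: measurable_funM.
    by move=> x; rewrite normrM mulr_ile1.
  rewrite intZZ (_ : q i j = p i * p j) ?subrr ?mule0//.
  by rewrite /q indep 1?eq_sym// fineM// ?pE.
under eq_bigr do rewrite row.
rewrite sumEFin lee_fin; apply: ler_sum => i _.
rewrite ler_piMr ?sqr_ge0//.
have : q i i = p i by rewrite /q setIid.
by have := p0 i; have := p1 i; nra.
Qed.

End second_moment.

(** * Measurability of the weighted empirical distribution function *)

Section sample.
Context (R : realType) (m n : nat).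
Implicit Types (w : 'I_n -> R) (x : 'rV[\bar R]_m).

Lemma wedf_indic w (xs : n.-tuple (m.-tuple R)) x :
  wedf w xs x = \sum_(i < n) w i * \1_(orthant x) (tnth xs i).
Proof.
apply: eq_bigr => i _; congr (_ * _); rewrite indicE; congr (_%:R).
by congr nat_of_bool; apply/idP/idP => [|]; rewrite inE.
Qed.

(** Joint measurability of the order relation; Tonelli's theorem requires it because the evaluation
    point is integrated too. *)
Lemma measurable_orthant_rel d (T : measurableType d) (f g : T -> m.-tuple R) :
  measurable_fun setT f -> measurable_fun setT g ->
  measurable [set s | orthant (ev_of (g s)) (f s)].
Proof.
move=> mf mg.
rewrite (_ : [set s | _] = \bigcap_(j in [set: 'I_m])
    [set s | tnth (f s) j <= tnth (g s) j]); last first.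
  apply/seteqP; split=> [s /=|s H].
    by rewrite orthantE => H i _; have := H i; rewrite /ev_of mxE lee_fin.
  by rewrite /= orthantE => i; rewrite /ev_of mxE lee_fin; exact: H.
apply: fin_bigcap_measurable => // i _.
rewrite -[X in measurable X]setTI.
have mt (h : T -> m.-tuple R) : measurable_fun setT h ->
    measurable_fun setT (fun s => (tnth (h s) i)%:E).
  move=> mh; apply/measurable_EFinP.
  by have /measurable_fun_tnthP/(_ i) := mh.
by have := measurable_lee measurableT (mt _ mf) (mt _ mg).
Qed.

(** The value at y is the [mu]-measure of the section at y of the set of pairs (y, z) with z <=
    y. *)
Lemma measurable_df_ev (mu : probability (m.-tuple R) R) :
  measurable_fun setT (fun y : m.-tuple R => df mu (ev_of y)).
Proof.
pose A := [set p : m.-tuple R * m.-tuple R | orthant (ev_of p.1) p.2].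
have mA : measurable A by exact: measurable_orthant_rel.
apply/measurable_EFinP.
rewrite (_ : _ \o _ = mu \o xsection A); first exact: measurable_fun_xsection.
apply/funext => y /=; rewrite df_EFin; congr (mu _).
by apply/seteqP; split => z; rewrite /xsection /= in_setE.
Qed.

Lemma measurable_wedf_ev d (T : measurableType d) w
    (f : T -> n.-tuple (m.-tuple R)) (g : T -> m.-tuple R) :
  measurable_fun setT f -> measurable_fun setT g ->
  measurable_fun setT (fun t => wedf w (f t) (ev_of (g t))).
Proof.
move=> mf mg; under eq_fun do rewrite wedf_indic.
apply: measurable_sum => i; apply: measurable_funM => //.
rewrite (_ : (fun _ => _) =
  \1_[set t | orthant (ev_of (g t)) (tnth (f t) i)]); last first.
  by apply/funext => t; rewrite !indicE; congr (_%:R);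
     apply/idP/idP; rewrite !inE.
apply: measurable_indic; apply: measurable_orthant_rel => //.
by have /measurable_fun_tnthP/(_ i) := mf.
Qed.

Lemma measurable_wedf w x :
  measurable_fun setT (fun xs : n.-tuple (m.-tuple R) => wedf w xs x).
Proof.
under eq_fun do rewrite wedf_indic.
apply: measurable_sum => i; apply: measurable_funM => //.
rewrite (_ : (fun _ => _) = \1_[set xs : n.-tuple _ | orthant x (tnth xs i)]).
  apply: measurable_indic; rewrite -[X in measurable X]setTI.
  by apply: measurable_tnth => //; exact: measurable_orthant.
by apply/funext => t; rewrite !indicE; congr (_%:R); apply/idP/idP; rewrite !inE.
Qed.

End sample.

(** * Second moments for pairwise independent samples *)

Section independent_sample.
Context d (T : measurableType d) (R : realType) (P : probability T R) (m n : nat).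
Implicit Types (w : 'I_n -> R) (x : 'rV[\bar R]_m).
Implicit Types (Y : 'I_n -> T -> m.-tuple R) (mu : 'I_n -> probability (m.-tuple R) R).

(** Common interface for the null sample under [iid_law] and the observations under the alternative,
    whose laws may differ. *)
Definition pairwise_sample Y mu : Prop :=
  [/\ forall i, measurable_fun setT (Y i),
      forall i B, measurable B -> P (Y i @^-1` B) = mu i B &
      forall i j B C, i != j -> measurable B -> measurable C ->
        P (Y i @^-1` B `&` Y j @^-1` C) = (mu i B * mu j C)%E].

Definition mean_df w mu x : R := \sum_(i < n) w i * df (mu i) x.

Variables (Y : 'I_n -> T -> m.-tuple R) (mu : 'I_n -> probability (m.-tuple R) R).
Hypothesis sY : pairwise_sample Y mu.

Definition sample (t : T) : n.-tuple (m.-tuple R) := [tuple Y i t | i < n].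

Lemma measurable_sample : measurable_fun setT sample.
Proof.
case: sY => mY _ _; apply/measurable_fun_tnthP => i.
rewrite (_ : _ \o _ = Y i); first exact: mY.
by apply/funext => t; rewrite /= tnth_mktuple.
Qed.

Lemma wedf_second_moment w x :
  (\int[P]_t ((wedf w (sample t) x - mean_df w mu x) ^+ 2)%:E
    <= (\sum_(i < n) w i ^+ 2)%:E)%E.
Proof.
case: sY => mY lawY indY.
have mO := measurable_orthant x.
apply: le_trans (@second_moment _ _ _ P n (fun i => Y i @^-1` orthant x) w _ _).
- rewrite le_eqVlt; apply/orP; left; apply/eqP.
  apply: eq_integral => t _; congr (_ ^+ 2)%:E.
  rewrite wedf_indic /mean_df -sumrB; apply: eq_bigr => i _.
  by rewrite tnth_mktuple -mulrBr lawY.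
- by move=> i; rewrite -[X in measurable X]setTI; exact: mY.
- by move=> i j ij; rewrite indY// !lawY.
Qed.

Lemma measurable_mean_df_ev w :
  measurable_fun setT (fun y : m.-tuple R => mean_df w mu (ev_of y)).
Proof.
apply: measurable_sum => i; apply: measurable_funM => //.
exact: measurable_df_ev.
Qed.

(** Tonelli exchanges the integrals; the pointwise second moment bound does not depend on y, and
    [nu] has mass one. *)
Lemma wedf_integrated_second_moment w (nu : probability (m.-tuple R) R) :
  (\int[P]_t \int[nu]_y
     ((wedf w (sample t) (ev_of y) - mean_df w mu (ev_of y)) ^+ 2)%:E
    <= (\sum_(i < n) w i ^+ 2)%:E)%E.
Proof.
pose f (p : T * m.-tuple R) :=
  ((wedf w (sample p.1) (ev_of p.2) - mean_df w mu (ev_of p.2)) ^+ 2)%:E.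
have mf : measurable_fun setT f.
  apply/measurable_EFinP; apply: measurable_funX; apply: measurable_funB.
    apply: measurable_wedf_ev => //.
    by apply: measurableT_comp => //; exact: measurable_sample.
  apply: (measurableT_comp (f := fun y => mean_df w mu (ev_of y))) => //.
  exact: measurable_mean_df_ev.
have f0 p : (0 <= f p)%E by rewrite lee_fin sqr_ge0.
rewrite (fubini_tonelli (m1 := P) (m2 := nu) f)//.
apply: (@le_trans _ _ (\int[nu]_y (\sum_(i < n) w i ^+ 2)%:E)%E); last first.
  rewrite integral_cst// [X in (_ * X <= _)%E](_ : _ = 1%E) ?mule1//.
  exact: probability_setT.
apply: ge0_le_integral => //.
- by move=> y _; apply: integral_ge0 => t _.
- exact: (measurable_fun_fubini_tonelli_G (m1 := P) f).
- by move=> y _; exact: (wedf_second_moment w (ev_of y)).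
Qed.

End independent_sample.

(** * The null sample and the observed sample *)

Section samples.
Context d (T : measurableType d) (R : realType) (P : probability T R) (m n : nat).

Lemma iid_law_sample (nu : probability (m.-tuple R) R) :
  pairwise_sample (iid_law nu n) (fun (i : 'I_n) t => tnth t i) (fun=> nu).
Proof.
split=> [i|i B mB|i j B C ij mB mC].
- exact: measurable_tnth.
(* The event is a rectangle whose sides other than i are the whole space, so [iid_lawE] applies; the
   event for a pair is treated alike. *)
- rewrite (_ : _ @^-1` _ = [set y : n.-tuple (m.-tuple R) |
      forall k, (if k == i then B else setT) (tnth y k)]); last first.
    apply/seteqP; split => y /=; last by move/(_ i); rewrite eqxx.
    by move=> By k; case: eqP => [->|].
  rewrite (iid_lawE nu (B := fun k => if k == i then B else setT)); last first.
    by move=> k; case: ifP.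
  rewrite (bigD1 i)//= eqxx big1 ?mule1// => k /negbTE ->.
  exact: probability_setT.
- rewrite (_ : _ `&` _ = [set y : n.-tuple (m.-tuple R) |
      forall k, (if k == i then B else if k == j then C else setT) (tnth y k)]);
      last first.
    apply/seteqP; split => y /=.
      by move=> [By Cy] k; case: eqP => [->//|_]; case: eqP => [->|].
    move=> H; have := H i; rewrite eqxx; split => //.
    by have := H j; rewrite eq_sym (negbTE ij) eqxx.
  rewrite (iid_lawE nu
    (B := fun k => if k == i then B else if k == j then C else setT)); last first.
    by move=> k; case: ifP => // _; case: ifP.
  have ji : j != i by rewrite eq_sym.
  rewrite (bigD1 i)//= eqxx (bigD1 j)//= (negbTE ji) eqxx.
  rewrite big1 ?mule1// => k /andP[/negbTE -> /negbTE ->].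
  exact: probability_setT.
Qed.

Lemma mutually_independent_sample (X : nat -> {RV P >-> m.-tuple R}) :
  mutually_independent X ->
  pairwise_sample P (fun (i : 'I_n) t => X i t)
    (fun i => distribution P (X i)).
Proof.
move=> hX; split=> [i|i B mB//|i j B C ij mB mC].
  exact: measurable_funP.
(* Mutual independence is used on the two-element index set, with [B] at i and [C] at every other
   index. *)
have := hX [fset (i : nat); (j : nat)]%fset
  (fun k => if k == i then B else C) (fun k => _).
rewrite big_fsetU1/= ?inE// big_seq_fset1 eqxx.
rewrite [(j : nat) == i]eq_sym (negbTE ij : (i == j :> nat) = false).
move=> <-; last by move=> k; case: ifP.
congr (P _); apply/seteqP; split=> t /=.
  move=> [Bt Ct] k /=; rewrite !inE => /orP[]/eqP ->; first by rewrite eqxx.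
  by rewrite [(j : nat) == i]eq_sym (negbTE ij : (i == j :> nat) = false).
move=> H; split.
  by have := H (i : nat); rewrite /= !inE eqxx; apply.
have := H (j : nat); rewrite /= !inE eqxx orbT.
by rewrite [(j : nat) == i]eq_sym (negbTE ij : (i == j :> nat) = false); apply.
Qed.

Lemma sample_tnth :
  sample (fun (i : 'I_n) (t : n.-tuple (m.-tuple R)) => tnth t i) = id.
Proof. by apply/funext => t; apply: eq_from_tnth => i; rewrite tnth_mktuple. Qed.

End samples.

(** * Countable approximation of extended reals from above *)

Section rational_upper_approximation.
Context {R : realType}.
Implicit Types t : \bar R.

(** Index 0 is reserved for +oo, so that the empty minimum in [rat_above] is itself a value of the
    enumeration. *)
Definition rat_or_pinfty (k : nat) : \bar R :=
  if k is k'.+1 then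
    if (choice.unpickle k' : option rat) is Some q then (ratr q)%:E else +oo%E
  else +oo%E.

(** A running minimum makes the approximation nonincreasing in k, as continuity of measures from
    above requires. *)
Definition rat_above (k : nat) t : \bar R :=
  \big[Order.min/+oo%E]_(i < k | (t < rat_or_pinfty i)%E) rat_or_pinfty i.

Lemma rat_above_range k t : exists i, rat_above k t = rat_or_pinfty i.
Proof.
rewrite /rat_above; elim/big_ind: _ => [|u v [i ->] [j ->]|i _].
- by exists 0%N.
- by rewrite /Order.min; case: ifP => _; [exists i|exists j].
- by exists i.
Qed.

Lemma rat_above_nincr k l t : (k <= l)%N -> (rat_above l t <= rat_above k t)%E.
Proof.
exact: (le_bigmin_ord (fun i => (t < rat_or_pinfty i)%E) rat_or_pinfty).
Qed.

(** This is convergence of [rat_above k t] down to t, tested against real y: if t < y, a rational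
    strictly between them eventually enters the minimum. *)
Lemma rat_aboveP (y : R) t :
  (forall k, (y%:E <= rat_above k t)%E) <-> (y%:E <= t)%E.
Proof.
split=> [H|yt k]; last first.
  apply: le_bigmin => [|i ti]; first exact: leey.
  exact: le_trans yt (ltW ti).
rewrite leNgt; apply/negP => ty.
have [q tq qy] : exists2 q, (t < (ratr q)%:E)%E & ratr q < y.
  case: t ty {H} => [r| |]//= ry.
    have [q] := rat_in_itvoo ry; rewrite in_itv /= => /andP[rq qy].
    by exists q.
  have y1 : y - 1 < y by lra.
  have [q] := rat_in_itvoo y1; rewrite in_itv /= => /andP[rq qy].
  by exists q => //; exact: ltNyr.
have eq : rat_or_pinfty (choice.pickle q).+1 = (ratr q)%:E by rewrite /= choice.pickleK.
(* One successor comes from the slot reserved for +oo, the other from the minimum running over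
   indices strictly below its bound. *)
have := H (choice.pickle q).+2; apply/negP; rewrite -ltNge.
apply: (@le_lt_trans _ _ (ratr q)%:E); last by rewrite lte_fin.
rewrite -eq; have qlt : ((choice.pickle q).+1 < (choice.pickle q).+2)%N by [].
have := @bigmin_le_cond _ _ _ +oo%E (Ordinal qlt)
  (fun i : 'I_(choice.pickle q).+2 => (t < rat_or_pinfty i)%E)
  (fun i => rat_or_pinfty i).
by apply; rewrite eq.
Qed.

End rational_upper_approximation.

(** * The unscaled statistics and their measurability *)

Section statistics_measurability.
Context (R : realType) (m n : nat).
Implicit Types (w : 'I_n -> R) (x u v : 'rV[\bar R]_m).
Implicit Types xs : n.-tuple (m.-tuple R).

(** Right-continuity: the approximating orthants decrease to [orthant x], and [mu] is continuous
    from above. *)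
Lemma df_rat_above_cvg (mu : probability (m.-tuple R) R) x :
  df mu (\row_j rat_above k (x ord0 j)) @[k --> \oo] --> df mu x.
Proof.
pose F k := orthant (\row_j rat_above k (x ord0 j)).
have FE : \bigcap_k F k = orthant x.
  apply/seteqP; split=> y.
    move=> Fy; rewrite orthantE => j; apply/rat_aboveP => k.
    by have := Fy k I; rewrite /F orthantE => /(_ j); rewrite mxE.
  rewrite orthantE => yx k _; rewrite /F orthantE => j; rewrite mxE.
  by move: k; apply/rat_aboveP; exact: yx.
have : mu \o F @ \oo --> mu (\bigcap_n F n).
  apply: nonincreasing_cvg_mu.
  - by rewrite (le_lt_trans (probability_le1 _ _)) ?ltry//; exact: measurable_orthant.
  - by move=> i; exact: measurable_orthant.
  - by rewrite FE; exact: measurable_orthant.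
  - move=> k l kl; apply/subsetPset => y; rewrite /F !orthantE => H j.
    by rewrite (le_trans (H j))// !mxE; exact: rat_above_nincr.
by rewrite FE -df_EFin => /fine_cvg.
Qed.

(** Seen as a combination of distribution functions of point masses, [wedf] inherits
    right-continuity and monotonicity from [df]. *)
Lemma wedf_df w (xs : n.-tuple (m.-tuple R)) x :
  wedf w xs x = \sum_(i < n) w i * df \d_(tnth xs i) x.
Proof.
rewrite wedf_indic; apply: eq_bigr => i _.
by rewrite /df [X in fine X](diracE _ (tnth xs i)) indicE.
Qed.

Lemma wedf_rat_above_cvg w xs x :
  wedf w xs (\row_j rat_above k (x ord0 j)) @[k --> \oo] --> wedf w xs x.
Proof.
under eq_fun do rewrite wedf_df.
rewrite wedf_df.
apply: cvg_big => [|i _]; first exact: add_continuous.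
by apply: cvgMl_tmp; exact: df_rat_above_cvg.
Qed.

Lemma wedf_ge0 w xs x : (forall i, 0 <= w i) -> 0 <= wedf w xs x.
Proof. by move=> w0; apply: sumr_ge0 => i _; rewrite mulr_ge0. Qed.

Lemma wedf_le w xs x : (forall i, 0 <= w i) -> wedf w xs x <= \sum_(i < n) w i.
Proof.
by move=> w0; apply: ler_sum => i _; rewrite ler_piMr// lern1 leq_b1.
Qed.

Lemma wedf_homo w xs u v : (forall i, 0 <= w i) -> ev_le u v ->
  wedf w xs u <= wedf w xs v.
Proof.
move=> w0 uv; rewrite !wedf_df; apply: ler_sum => i _.
by rewrite ler_wpM2l//; exact: df_le.
Qed.

Lemma mean_df_ge0 w (mu : 'I_n -> probability (m.-tuple R) R) x :
  (forall i, 0 <= w i) -> 0 <= mean_df w mu x.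
Proof.
by move=> w0; apply: sumr_ge0 => i _; rewrite mulr_ge0 ?df_ge0.
Qed.

Lemma mean_df_le w (mu : 'I_n -> probability (m.-tuple R) R) x :
  (forall i, 0 <= w i) -> mean_df w mu x <= \sum_(i < n) w i.
Proof.
by move=> w0; apply: ler_sum => i _; rewrite ler_piMr// df_le1.
Qed.

Definition KSdist w (G : 'rV[\bar R]_m -> R) xs : R :=
  sup (range (fun x => `|wedf w xs x - G x|)).

Variables (w : 'I_n -> R) (w0 : forall i, 0 <= w i)
  (nu : probability (m.-tuple R) R).

Lemma wedf_df_dist_le xs x : `|wedf w xs x - df nu x| <= \sum_(i < n) w i + 1.
Proof.
have := df_ge0 nu x; have := df_le1 nu x; have := wedf_ge0 xs x w0.
have := wedf_le xs x w0; rewrite ler_norml; lra.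
Qed.

Lemma KSdist_ubound xs : has_ubound (range (fun x => `|wedf w xs x - df nu x|)).
Proof.
by exists (\sum_(i < n) w i + 1) => _ [x _ <-]; exact: wedf_df_dist_le.
Qed.

Lemma KSdist_ge xs x : `|wedf w xs x - df nu x| <= KSdist w (df nu) xs.
Proof. by apply: ub_le_sup; [exact: KSdist_ubound|exists x]. Qed.

Lemma KSdist_le xs (e : R) : (forall x, `|wedf w xs x - df nu x| <= e) ->
  KSdist w (df nu) xs <= e.
Proof.
move=> H; apply: ge_sup; last by move=> _ [x _ <-]; exact: H.
by exists `|wedf w xs (const_mx 0%E) - df nu (const_mx 0%E)|, (const_mx 0%E).
Qed.

(* [P] is meaningful on measurable sets only, so the supremum over [-oo, +oo]^m
   is first reduced, by right-continuity, to a countable set of points. *)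
Lemma measurable_KSdist : measurable_fun setT (KSdist w (df nu)).
Proof.
(* The countable set: all coordinates rational or +oo. Undecodable codes yield the origin, a
   legitimate point that cannot raise the supremum above [KSdist]. *)
pose pt k : 'rV[\bar R]_m :=
  if (choice.unpickle k : option {ffun 'I_m -> nat}) is Some f then
    \row_j rat_or_pinfty (f j) else \row_j 0%E.
pose h k xs := `|wedf w xs (pt k) - df nu (pt k)|.
have hub xs : has_ubound (range (h^~ xs)).
  by exists (\sum_(i < n) w i + 1) => _ [k _ <-]; exact: wedf_df_dist_le.
rewrite (_ : KSdist _ _ = fun xs => sups (h^~ xs) 0%N).
  apply: measurable_fun_sups => // k; apply: measurableT_comp => //.
  by apply: measurable_funB => //; exact: measurable_wedf.
apply/funext => xs; apply/eqP; rewrite eq_le; apply/andP; split.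
  (* The deviation at x is the limit of deviations at the approximants of x, each of which is some
     [pt k]. *)
  apply: KSdist_le => x.
  have := @df_rat_above_cvg nu x; have := @wedf_rat_above_cvg w xs x.
  move=> /cvgB /[apply] /cvg_norm /cvgr_to_le; apply.
  near=> k.
  have [f fE] := choice (fun j : 'I_m => rat_above_range k (x ord0 j)).
  apply: ub_le_sup.
    apply: subset_has_ubound (hub xs) => _ [l _ <-]; by exists l.
  exists (choice.pickle [ffun j => f j]) => //=.
  rewrite /h /pt choice.pickleK.
  rewrite (_ : \row_j rat_or_pinfty _ = \row_j rat_above k (x ord0 j))//.
  by apply/rowP => j; rewrite !mxE ffunE fE.
apply: ge_sup; first by exists (h 0%N xs), 0%N.
by move=> _ [k _ <-]; exact: KSdist_ge.
Unshelve. all: by end_near. Qed.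

Lemma KSdist_ge0 xs : 0 <= KSdist w (df nu) xs.
Proof. exact: le_trans (KSdist_ge xs (const_mx 0%E)). Qed.

(** The centring [G] is left free: [df nu] gives [CvM] without its factor n, and [mean_df] gives the
    error controlled by second moments. *)
Definition CvMdist (G : m.-tuple R -> R) xs : R :=
  \int[nu]_y (wedf w xs (ev_of y) - G y) ^+ 2.

Lemma CvMdist_ge0 G xs : 0 <= CvMdist G xs.
Proof. by apply: Rintegral_ge0 => y _; exact: sqr_ge0. Qed.

Variable G : m.-tuple R -> R.
Hypothesis mG : measurable_fun setT G.
Hypothesis G01 : forall y, 0 <= G y <= \sum_(i < n) w i + 1.

(** The integrand is bounded. The bound on [G] accommodates both centrings, since [df nu] is at most
    1 and [mean_df] at most the sum of the weights. *)
Lemma sqr_dist_integrable xs :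
  nu.-integrable setT (EFin \o (fun y => (wedf w xs (ev_of y) - G y) ^+ 2)).
Proof.
apply: (@bounded_integrable _ _ _ _ _ ((\sum_(i < n) w i + 1) ^+ 2)).
  apply: measurable_funX; apply: measurable_funB => //.
  exact: (measurable_wedf_ev w (f := fun=> xs) (g := id)).
move=> y; rewrite normrX lerXn2r ?nnegrE ?addr_ge0 ?sumr_ge0//.
have := wedf_ge0 xs (ev_of y) w0; have := wedf_le xs (ev_of y) w0.
by have := G01 y; rewrite ler_norml; lra.
Qed.

Lemma CvMdist_EFin xs : (CvMdist G xs)%:E =
  (\int[nu]_y ((wedf w xs (ev_of y) - G y) ^+ 2)%:E)%E.
Proof.
rewrite /CvMdist /Rintegral fineK//; apply: integrable_fin_num => //.
exact: sqr_dist_integrable.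
Qed.

Lemma measurable_CvMdist : measurable_fun setT (CvMdist G).
Proof.
apply/measurable_EFinP; rewrite (_ : _ \o _ = fun xs =>
  (\int[nu]_y ((wedf w xs (ev_of y) - G y) ^+ 2)%:E)%E); last first.
  by apply/funext => xs; exact: CvMdist_EFin.
apply: (measurable_fun_fubini_tonelli_F (m2 := nu) (fun p =>
  ((wedf w p.1 (ev_of p.2) - G p.2) ^+ 2)%:E)).
  apply/measurable_EFinP; apply: measurable_funX; apply: measurable_funB.
    exact: measurable_wedf_ev.
  exact: measurableT_comp.
by move=> p; rewrite lee_fin sqr_ge0.
Qed.

End statistics_measurability.

(** * Upper bounds for quantiles, and probabilities tending to one *)

Section quantiles_and_limits.
Context d (T : measurableType d) (R : realType) (P : probability T R).

Lemma probability_compl_le (A : set T) (e : R) : measurable A ->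
  (P (~` A) <= e%:E)%E -> ((1 - e)%:E <= P A)%E.
Proof.
move=> mA; rewrite probability_setC// -[P A]fineK ?fin_num_measure//.
by rewrite -EFinB !lee_fin; lra.
Qed.

(** P(U < c) >= 1 - alpha puts s c into the set whose infimum is the quantile. Nonnegativity of S
    and [alpha < 1] bound that set below by 0, so that [inf] is a true infimum. *)
Lemma quantile_scale_le (S U : T -> R) (s c alpha : R) :
  (forall t, S t = s * U t) -> 0 <= s -> measurable_fun setT U ->
  (forall t, 0 <= U t) -> alpha < 1 ->
  (P [set t | (c <= U t)%R] <= alpha%:E)%E ->
  quantile P S (1 - alpha) <= s * c.
Proof.
move=> SE s0 mU U0 alpha1 Pc.
have mS : measurable_fun setT S.
  by rewrite (funext SE); exact: measurable_funM.
apply: ge_inf.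
  exists 0 => t /= Pt; rewrite leNgt; apply/negP => t0.
  move: Pt; rewrite (_ : [set w | _] = set0).
    by rewrite measure0 lee_fin; lra.
  apply/seteqP; split => // w /= Sw.
  by have : 0 <= S w; [rewrite SE mulr_ge0|lra].
rewrite /=; apply: (@le_trans _ _ (P (~` [set t | c <= U t]))).
  by apply: probability_compl_le; [exact/measurableC/measurable_ge|rewrite setCK].
apply: le_measure; rewrite ?inE; [exact/measurableC/measurable_ge|exact: measurable_le|].
move=> t /= /negP; rewrite -ltNge SE => /ltW; exact: ler_wpM2l.
Qed.

Lemma cvg_probability1 (A : nat -> set T) : (forall n, measurable (A n)) ->
  (forall e : R, 0 < e -> \forall n \near \oo, (P (~` A n) <= e%:E)%E) ->
  P (A n) @[n --> \oo] --> (1%:E : \bar R).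
Proof.
move=> mA HA.
have PE n : P (A n) = (fine (P (A n)))%:E by rewrite fineK ?fin_num_measure.
under eq_fun do rewrite PE.
apply: cvg_EFin; first exact: nearW.
apply/cvgrPdist_le => e e0; near=> n => /=.
have := @probability_compl_le (A n) e (mA n); rewrite PE lee_fin.
have : fine (P (A n)) <= 1 by rewrite -lee_fin -PE probability_le1.
move=> p1 /(_ _) p2; rewrite ler_norml.
have : (P (~` A n) <= e%:E)%E by near: n; exact: HA.
by move=> /p2; lra.
Unshelve. all: by end_near. Qed.

End quantiles_and_limits.

(** * Asymptotics of the weights and of the mean distribution function *)

Section weights.
Context (R : realType) (a : forall n : nat, 'I_n -> R) (kappa : R).
Hypothesis ha_ge0 : forall (n : nat) (i : 'I_n), 0 <= a i.
Hypothesis ha_sum : forall n : nat, (0 < n)%N -> \sum_(i < n) a i = 1.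

Lemma sum_sqr_weights_cvg0 :
  n%:R * (\sum_(i < n) a i ^+ 2) @[n --> \oo] --> kappa ->
  (\sum_(i < n) a i ^+ 2) @[n --> \oo] --> (0 : R).
Proof.
move=> ha.
have : (n%:R * (\sum_(i < n) a i ^+ 2)) * n%:R^-1 @[n --> \oo] --> kappa * 0.
  apply: cvgM => //; apply/cvgrPdist_lt => e e0; near=> n.
  have n0 : (0 < n)%N by near: n; exact: nbhs_infty_gt.
  rewrite sub0r normrN ger0_norm// invf_plt ?posrE ?ltr0n//.
  near: n; exact: nbhs_infty_gtr.
rewrite mulr0; apply: cvg_trans; apply: near_eq_cvg; near=> n.
have n0 : (0 < n)%N by near: n; exact: nbhs_infty_gt.
by rewrite mulrC mulrA mulVf ?mul1r// pnatr_eq0 -lt0n.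
Unshelve. all: by end_near. Qed.

Lemma max_weight_cvg0 :
  Num.sqrt n%:R * (\big[Num.max/0]_(i < n) a i) @[n --> \oo] --> (0 : R) ->
  (\big[Num.max/0]_(i < n) a i) @[n --> \oo] --> (0 : R).
Proof.
move=> ha; apply: (squeeze_cvgr _ (cvg_cst 0) ha).
near=> n; have n0 : (0 < n)%N by near: n; exact: nbhs_infty_gt.
have max0 : 0 <= \big[Num.max/0]_(i < n) a i by exact: bigmax_ge_id.
by rewrite max0 ler_peMl// -{1}sqrtr1 ler_wsqrtr// ler1n.
Unshelve. all: by end_near. Qed.

(** A Toeplitz argument: from index N on, the distribution functions are within e/2 of the limit,
    and the first N terms cost at most N times the largest weight, which tends to 0. *)
Lemma mean_df_cvg (m : nat) (mu_ : nat -> probability (m.-tuple R) R)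
    (mu : probability (m.-tuple R) R) :
  {uniform, (fun i => df (mu_ i)) @ \oo --> df mu} ->
  (\big[Num.max/0]_(i < n) a i) @[n --> \oo] --> (0 : R) ->
  forall e : R, 0 < e -> \forall n \near \oo, forall x : 'rV[\bar R]_m,
    `|mean_df (@a n) (fun i => mu_ i) x - df mu x| < e.
Proof.
move=> hmu hmax e e0.
have e20 : 0 < e / 2 by lra.
have [N _ HN] := df_uniform_cvg hmu e20.
near=> n; move=> x.
have n0 : (0 < n)%N by near: n; exact: nbhs_infty_gt.
set M := \big[Num.max/0]_(i < n) a i.
have M0 : 0 <= M by exact: bigmax_ge_id.
(* Dividing by N + 1 covers the case N = 0. *)
have MN : N%:R * M < e / 2.
  rewrite -(@ltr_pM2r _ (N.+1%:R^-1)) ?invr_gt0 ?ltr0n//.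
  apply: (@le_lt_trans _ _ M).
    by rewrite ler_pdivrMr ?ltr0n// mulrC ler_wpM2l// ler_nat.
  have : `|0 - M| < e / 2 / N.+1%:R.
    rewrite /M; near: n; move/cvgrPdist_lt: hmax; apply.
    by rewrite divr_gt0 ?ltr0n.
  by rewrite sub0r normrN ger0_norm.
rewrite -[df mu x]mul1r -(ha_sum n0) mulr_suml -sumrB.
under eq_bigr do rewrite -mulrBr.
apply: (le_lt_trans (ler_norm_sum _ _ _)).
(* Every term is allotted its share of e/2; those with i < N are also allotted [M], which dominates
   them because two distribution functions differ by at most 1. *)
apply: (@le_lt_trans _ _ (\sum_(i < n) (a i * (e / 2) + (i < N)%:R * M))).
  apply: ler_sum => i _; rewrite normrM ger0_norm//.
  have [iN|Ni] := ltnP i N.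
    have aM : a i <= M by exact: le_bigmax.
    have : `|df (mu_ i) x - df mu x| <= 1.
      have := df_ge0 (mu_ i) x; have := df_le1 (mu_ i) x.
      by have := df_ge0 mu x; have := df_le1 mu x; rewrite ler_norml; lra.
    move=> d1; have := ler_wpM2l (ha_ge0 i) d1; rewrite mulr1 mul1r.
    have : 0 <= a i * (e / 2) by rewrite mulr_ge0// ltW.
    lra.
  by rewrite mul0r addr0 ler_wpM2l// ltW// HN.
rewrite big_split/= -mulr_suml ha_sum// mul1r -mulr_suml.
suff : \sum_(i < n) ((i < N)%N%:R : R) <= N%:R.
  by move=> H; have := ler_wpM2r M0 H; lra.
rewrite -natr_sum ler_nat.
suff -> : (\sum_(i < n) (i < N) = minn n N)%N by exact: geq_minr.
elim: (n) => [|k IHk]; first by rewrite big_ord0 min0n.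
by rewrite big_ord_recr/= IHk; have [kN|Nk] := ltnP k N; lia.
Unshelve. all: by end_near. Qed.

End weights.

(** * Finite grids on the compactified space *)

Section grid.
Context {R : realType}.
Implicit Types (K : nat) (t : \bar R).

(** Nodes equidistant on the [contract] scale; the first is -oo and the last +oo. *)
Definition grid K (k : 'I_K.+2) : \bar R := expand (k%:R * (2 / K.+1%:R) - 1).

Lemma contract_grid K (k : 'I_K.+2) :
  contract (grid k) = k%:R * (2 / K.+1%:R) - 1.
Proof.
rewrite /grid expandK// inE /=.
have kK : (k%:R : R) <= K.+1%:R by rewrite ler_nat -ltnS.
have K0 : (0 : R) < K.+1%:R by rewrite ltr0n.
have : (k%:R : R) * (2 / K.+1%:R) <= 2.
  by rewrite mulrCA ler_piMr// ler_pdivrMr// mul1r.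
have : 0 <= (k%:R : R) * (2 / K.+1%:R) by rewrite mulr_ge0// divr_ge0.
by rewrite ler_norml; move: (_ * _) => z z0 z2; lra.
Qed.

(** u is the first node at or above t and l its predecessor, hence l < t. If u is the first node of
    all, then t = -oo and l = u. Strictness serves to place points in half-open cells. *)
Lemma grid_bracket1 K t : exists l u : 'I_K.+2,
  [/\ (grid l <= t <= grid u)%E, t != -oo%E -> (grid l < t)%E &
      `|contract (grid l) - contract (grid u)| <= 2 / K.+1%:R].
Proof.
have gE k : (k < K.+2)%N -> grid (inord k : 'I_K.+2) = expand (k%:R * (2 / K.+1%:R) - 1).
  by move=> kK; rewrite /grid inordK.
have ex : exists k, (k < K.+2)%N && (t <= grid (inord k : 'I_K.+2))%E.
  exists K.+1; rewrite ltnSn gE// expand1 ?leey//.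
  have -> : K.+1%:R * (2 / K.+1%:R) = 2 :> R by rewrite mulrCA mulfV ?pnatr_eq0// mulr1.
  lra.
case: (ex_minnP ex) => k /andP[kK tk] kmin.
case: k kK tk kmin => [_ t0 _|k kK tk kmin].
  exists ord0, ord0; rewrite subrr normr0 divr_ge0//.
  have g0 : grid (ord0 : 'I_K.+2) = -oo%E.
    by rewrite /grid mul0r sub0r expandN1.
  move: t0; rewrite gE// mul0r sub0r expandN1// leeNy_eq => /eqP ->.
  by rewrite g0 lexx.
have kK' : (k < K.+2)%N by exact: ltnW.
have lt : (grid (inord k : 'I_K.+2) < t)%E.
  rewrite ltNge; apply/negP => tk'.
  by have := kmin k; rewrite kK' tk' ltnn => /(_ isT).
exists (inord k), (inord k.+1); split => //; first by rewrite (ltW lt).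
rewrite !contract_grid !inordK// -[k.+1]addn1 natrD.
have : 0 <= 2 / K.+1%:R :> R by rewrite divr_ge0.
by rewrite ler_norml; move: (2 / _) => z z0; lra.
Qed.

Definition gridv (m : nat) K (f : {ffun 'I_m -> 'I_K.+2}) : 'rV[\bar R]_m :=
  \row_j grid (f j).

Lemma grid_bracket (m : nat) (dlt : R) : 0 < dlt -> exists K,
  forall x : 'rV[\bar R]_m, exists l u : {ffun 'I_m -> 'I_K.+2},
  [/\ ev_le (gridv l) x, ev_le x (gridv u),
      forall j, x ord0 j != -oo%E -> (gridv l ord0 j < x ord0 j)%E &
      forall j, `|contract (gridv l ord0 j) - contract (gridv u ord0 j)| < dlt].
Proof.
move=> dlt0; pose K := Num.truncn (2 / dlt).
have K2 : 2 / K.+1%:R < dlt.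
  rewrite ltr_pdivrMr ?ltr0n// mulrC -ltr_pdivrMr//.
  exact: truncnS_gt.
exists K => x.
have [l /choice[u lu]] := choice (fun j => grid_bracket1 K (x ord0 j)).
exists (finfun l), (finfun u); split.
- by apply/ev_leP => j; rewrite mxE ffunE; case: (lu j) => /andP[].
- by apply/ev_leP => j; rewrite mxE ffunE; case: (lu j) => /andP[].
- by move=> j; rewrite mxE ffunE; case: (lu j).
- move=> j; rewrite !mxE !ffunE; apply: le_lt_trans K2.
  by case: (lu j).
Qed.

End grid.

(** * Uniform deviation of the empirical distribution function *)

Section glivenko_cantelli.
Context (R : realType) (m : nat) (muG : probability (m.-tuple R) R).
Hypothesis Gcont : unif_continuous (df muG).

(** By monotonicity the deviation at x is at most e at a bracketing node plus the increment of
    [df nu] over the bracket. That increment is below 3e: e for [df muG] and e at each end for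
    replacing it by [df nu]. The grid depends on e and [muG] only. *)
Lemma KSdist_grid (e : R) : 0 < e -> exists K, forall n (w : 'I_n -> R)
    (nu : probability (m.-tuple R) R) (xs : n.-tuple (m.-tuple R)),
  (forall i, 0 <= w i) ->
  (forall x, `|df nu x - df muG x| < e) ->
  (forall f : {ffun 'I_m -> 'I_K.+2},
    `|wedf w xs (gridv f) - df nu (gridv f)| < e) ->
  KSdist w (df nu) xs <= 4 * e.
Proof.
move=> e0; have [dlt dlt0 Gdlt] := df_unif_continuous Gcont e0.
have [K HK] := @grid_bracket R m dlt dlt0; exists K => n w nu xs w0 Gnu Hg.
apply: KSdist_le => x; have [l [u [lx xu _ lu]]] := HK x.
have := Gdlt _ _ lu.
have := wedf_homo xs w0 lx; have := wedf_homo xs w0 xu.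
have := df_le nu lx; have := df_le nu xu.
have := df_le muG lx; have := df_le muG xu.
have := Hg l; have := Hg u.
have := Gnu (gridv l); have := Gnu (gridv u).
have := Gnu x.
by rewrite !ltr_norml ler_norml; lra.
Qed.

(** A distance of at least 5e exceeds 4e, so some node deviates by at least e; Markov's inequality
    is applied to the sum of squared deviations over all nodes, whose number is [N]. *)
Lemma KSdist_tail (e : R) : 0 < e -> exists N : nat, forall n (w : 'I_n -> R)
    (nu : probability (m.-tuple R) R),
  (forall i, 0 <= w i) -> \sum_(i < n) w i = 1 ->
  (forall x, `|df nu x - df muG x| < e) ->
  (iid_law nu n [set xs | (5 * e <= KSdist w (df nu) xs)%R]
    <= (N%:R * (\sum_(i < n) w i ^+ 2) / e ^+ 2)%:E)%E.
Proof.
move=> e0; have [K HK] := KSdist_grid e0.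
exists #|{ffun 'I_m -> 'I_K.+2}| => n w nu w0 w1 Gnu.
have meanE x : mean_df w (fun=> nu) x = df nu x.
  by rewrite /mean_df -mulr_suml w1 mul1r.
pose D (f : {ffun 'I_m -> 'I_K.+2}) xs :=
  (wedf w xs (gridv f) - df nu (gridv f)) ^+ 2.
have mD f : measurable_fun setT (D f).
  by apply: measurable_funX; apply: measurable_funB => //; exact: measurable_wedf.
have mSD : measurable_fun setT (fun xs => \sum_f D f xs).
  exact: measurable_sum.
have D0 f xs : 0 <= D f xs by exact: sqr_ge0.
have SD0 xs : 0 <= \sum_f D f xs by exact: sumr_ge0.
have intD : (\int[iid_law nu n]_xs (\sum_f D f xs)%:E <=
    (#|{ffun 'I_m -> 'I_K.+2}|%:R * \sum_(i < n) w i ^+ 2)%:E)%E.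
  under eq_integral do rewrite -sumEFin.
  rewrite ge0_integral_sum//; first last.
  - by move=> f xs _; rewrite lee_fin.
  - by move=> f; exact/measurable_EFinP.
  rewrite mulr_natl -sumr_const -sumEFin; apply: lee_sum => f _.
  have := wedf_second_moment (iid_law_sample n nu) w (gridv f).
  by rewrite sample_tnth meanE.
have e20 : 0 < e ^+ 2 by rewrite exprn_gt0.
apply: le_trans (markov_bound mSD SD0 intD e20).
apply: le_measure; rewrite ?inE.
- by apply: measurable_ge; exact: measurable_KSdist.
- exact: measurable_ge.
move=> xs /=; apply: contraTT; rewrite -!ltNge => H.
apply: (@le_lt_trans _ _ (4 * e)); last lra.
apply: HK => // f; rewrite -(@ltr_pXn2r _ 2)// ?nnegrE ?(ltW e0)//.
rewrite real_normK ?num_real//; apply: le_lt_trans H.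
by rewrite (bigD1 f)//= lerDl sumr_ge0.
Qed.

End glivenko_cantelli.

(** * Integrated squared deviations *)

Section CvMdist_bounds.
Context d (T : measurableType d) (R : realType) (P : probability T R) (m n : nat).
Variables (Y : 'I_n -> T -> m.-tuple R) (mu : 'I_n -> probability (m.-tuple R) R).
Variables (w : 'I_n -> R) (w0 : forall i, 0 <= w i).
Variable nu : probability (m.-tuple R) R.

Lemma mean_df_ev_bound y : 0 <= mean_df w mu (ev_of y) <= \sum_(i < n) w i + 1.
Proof.
rewrite mean_df_ge0//= (le_trans (mean_df_le _ _ _))//.
by rewrite lerDl.
Qed.

(** Centring at the mean makes one bound serve both the null, where the mean is [df nu], and the
    alternative. *)
Lemma CvMdist_tail (c : R) : pairwise_sample P Y mu -> 0 < c ->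
  (P [set t | (c <= CvMdist w nu (fun y => mean_df w mu (ev_of y)) (sample Y t))%R]
    <= ((\sum_(i < n) w i ^+ 2) / c)%:E)%E.
Proof.
move=> sY c0; apply: markov_bound => //.
- apply: measurableT_comp; last exact: measurable_sample sY.
  apply: measurable_CvMdist => //; [exact: measurable_mean_df_ev|].
  exact: mean_df_ev_bound.
- by move=> t; exact: CvMdist_ge0.
- under eq_integral.
    move=> t _; rewrite CvMdist_EFin//; last 2 first.
    + exact: measurable_mean_df_ev.
    + exact: mean_df_ev_bound.
    over.
  exact: wedf_integrated_second_moment.
Qed.

(* W = wedf, M = mean_df, D = df nu: (W - D)^2 + (W - M)^2 >= (M - D)^2 / 2. *)
Lemma CvMdist_lower (C : set (m.-tuple R)) (eta : R) xs : 0 <= eta ->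
  measurable C ->
  (forall y, C y -> eta <= `|mean_df w mu (ev_of y) - df nu (ev_of y)|) ->
  eta ^+ 2 / 2 * fine (nu C) <= CvMdist w nu (fun y => df nu (ev_of y)) xs +
    CvMdist w nu (fun y => mean_df w mu (ev_of y)) xs.
Proof.
move=> eta0 mC HC.
have i1 := sqr_dist_integrable w0 nu (measurable_df_ev nu) (fun y => _) xs.
have i2 := sqr_dist_integrable w0 nu (measurable_mean_df_ev mu w) mean_df_ev_bound xs.
have {}i1 : nu.-integrable setT
    (EFin \o (fun y => (wedf w xs (ev_of y) - df nu (ev_of y)) ^+ 2)).
  apply: i1 => y; rewrite df_ge0/= (le_trans (df_le1 _ _))// lerDr.
  exact: sumr_ge0.
have i3 : nu.-integrable setT (EFin \o (\1_C : _ -> R)) by exact: integrable_indic.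
rewrite /CvMdist -RintegralD//.
have -> : fine (nu C) = \int[nu]_y \1_C y.
  by rewrite /Rintegral integral_indic// setIT.
rewrite -RintegralZl//.
apply: le_Rintegral => //.
- apply: (@bounded_integrable _ _ _ _ _ (eta ^+ 2 / 2)).
    by apply: measurable_funM => //; exact: measurable_indic.
  move=> y; have e0 : 0 <= eta ^+ 2 / 2 by rewrite divr_ge0// sqr_ge0.
  by rewrite indicE normrM ger0_norm// ler_piMr// ger0_norm// lern1 leq_b1.
- exact: (integrableD measurableT i1 i2).
move=> y _; rewrite indicE.
have [yC|_] := boolP (y \in C); last by rewrite mulr0 addr_ge0// sqr_ge0.
rewrite mulr1; have := HC y (set_mem yC).
set M := mean_df _ _ _; set D := df _ _; set W := wedf _ _ _ => HMD.
have : eta ^+ 2 <= (M - D) ^+ 2.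
  by rewrite -[leRHS]real_normK ?num_real// lerXn2r ?nnegrE.
(* Parallelogram law: the squares of the sum and of the difference M - D add up to 2 (W - D)^2 + 2
   (W - M)^2. *)
have : 0 <= ((W - D) + (W - M)) ^+ 2 by exact: sqr_ge0.
nra.
Qed.

End CvMdist_bounds.

(** * Half-open boxes and their measures *)

Section cells.
Context (R : realType) (m : nat).
Implicit Types (mu : probability (m.-tuple R) R) (l x : 'rV[\bar R]_m).

(* At [s := enum 'I_m] this is the half-open box ]l, x]; adding one coordinate
   at a time to [s] is what makes [cell_cvg] an induction. *)
Definition cell l (s : seq 'I_m) x : set (m.-tuple R) :=
  orthant x `&` [set y | forall j, j \in s -> (l ord0 j < (tnth y j)%:E)%E].

Definition set_coord x (j : 'I_m) (t : \bar R) : 'rV[\bar R]_m :=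
  \row_k if k == j then t else x ord0 k.

Lemma cell_nil l x : cell l [::] x = orthant x.
Proof. by apply/seteqP; split=> [y []|y]. Qed.

(** The points violating the new constraint form a cell with a lowered corner. The minimum keeps
    that cell inside the original one even if l_j > x_j, so that in [cell_cvg] measures subtract. *)
Lemma cell_cons l j s x : cell l (j :: s) x =
  cell l s x `\` cell l s (set_coord x j (Order.min (x ord0 j) (l ord0 j))).
Proof.
apply/seteqP; split=> y; rewrite /cell !orthantE /=.
  move=> [yx ly]; split.
    by split=> // k ks; apply: ly; rewrite inE ks orbT.
  move=> [/(_ j) + _]; rewrite mxE eqxx le_min => /andP[_].
  by rewrite leNgt ly// mem_head.
move=> [[yx ly] H]; split=> // k; rewrite inE => /predU1P[->|]; last exact: ly.
rewrite ltNge; apply/negP => ylj; apply: H; split=> // i; rewrite mxE.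
by case: eqP => [->|_]; rewrite ?le_min ?yx.
Qed.

Lemma measurable_cell l s x : measurable (cell l s x).
Proof.
elim: s x => [|j s IH] x; first by rewrite cell_nil; exact: measurable_orthant.
by rewrite cell_cons; exact: measurableD.
Qed.

(** Inclusion-exclusion in inductive form: the measure of a cell is an alternating sum of values of
    [df] at corners. *)
Lemma cell_cvg (mu_ : nat -> probability (m.-tuple R) R) mu l s x :
  (forall x, df (mu_ n) x @[n --> \oo] --> df mu x) ->
  fine (mu_ n (cell l s x)) @[n --> \oo] --> fine (mu (cell l s x)).
Proof.
move=> H; elim: s x => [|j s IH] x.
  by rewrite cell_nil; exact: H.
rewrite cell_cons; set z := set_coord _ _ _.
have zx : cell l s z `<=` cell l s x.
  move=> y [yz ly]; split=> //; move: yz; rewrite !orthantE => yz k.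
  by apply: le_trans (yz k) _; rewrite mxE; case: eqP => [->|//]; rewrite ge_min lexx.
have E p : fine ((p : probability (m.-tuple R) R) (cell l s x `\` cell l s z)) =
    fine (p (cell l s x)) - fine (p (cell l s z)).
  have fp s' z' : p (cell l s' z') \is a fin_num.
    by rewrite fin_num_measure//; exact: measurable_cell.
  rewrite measureD; [|exact: measurable_cell|exact: measurable_cell|].
    by rewrite setIidr//; exact: (fineB (fp _ _) (fp _ _)).
  by rewrite -ge0_fin_numE// fp.
rewrite E; under eq_fun do rewrite E.
by apply: cvgB; exact: IH.
Qed.

(** On a fine grid F - G varies by at most 2e over a cell, so cells on which it is at least e in
    absolute value cover the set where it exceeds 3e. Were they all null, so would be that set. *)
Lemma exists_charged_cell (muF muG : probability (m.-tuple R) R) :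
  unif_continuous (df muF) -> unif_continuous (df muG) ->
  ~ {ae muG, forall y, df muF (ev_of y) - df muG (ev_of y) = 0} ->
  exists l x (eta : R), [/\ 0 < eta, 0 < fine (muG (cell l (enum 'I_m) x)) &
    forall y, cell l (enum 'I_m) x y ->
      eta <= `|df muF (ev_of y) - df muG (ev_of y)|].
Proof.
move=> Fc Gc nae.
pose h (y : m.-tuple R) := df muF (ev_of y) - df muG (ev_of y).
(* The set where h is nonzero is the countable union of these, so one is not negligible. The factor
   3 leaves e after an oscillation of 2e. *)
have [N nB] : exists N, ~ muG.-negligible [set y | 3 * N.+1%:R^-1 < `|h y|].
  apply: contrapT => H; apply: nae.
  apply: (@negligibleS _ _ _ muG
    (\bigcup_N [set y | 3 * N.+1%:R^-1 < `|h y|])); last first.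
    apply: negligible_bigcup => N; apply: contrapT => nN; apply: H.
    by exists N.
  move=> y /= hy; have h0 : 0 < `|h y| by rewrite normr_gt0; exact/eqP.
  exists (Num.truncn (3 / `|h y|)) => //=.
  rewrite ltr_pdivrMr ?ltr0n// mulrC -ltr_pdivrMr//.
  exact: truncnS_gt.
set e : R := N.+1%:R^-1 in nB.
have e0 : 0 < e by rewrite invr_gt0 ltr0n.
have [dF dF0 HF] := df_unif_continuous Fc e0.
have [dG dG0 HG] := df_unif_continuous Gc e0.
have dlt0 : 0 < Num.min dF dG by rewrite lt_min dF0.
have [K HK] := @grid_bracket R m _ dlt0.
pose C (p : {ffun 'I_m -> 'I_K.+2} * {ffun 'I_m -> 'I_K.+2}) :=
  cell (gridv p.1) (enum 'I_m) (gridv p.2).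
apply: contrapT => H; apply: nB.
have null p : (forall y, C p y -> e <= `|h y|) -> muG (C p) = 0%E.
  move=> Hp; apply/eqP; rewrite eq_le measure_ge0 andbT leNgt; apply/negP => Cp.
  apply: H; exists (gridv p.1), (gridv p.2), e; split => //.
  rewrite -lte_fin fineK// fin_num_measure//; exact: measurable_cell.
apply: (@negligibleS _ _ _ muG
  (\big[setU/set0]_(p | `[< forall y, C p y -> e <= `|h y| >]) C p)); last first.
  elim/big_ind: _ => [|A B nA nB'|p /asboolP Hp].
  - exact: negligible_set0.
  - exact: negligibleU.
  - by apply/negligibleP; [exact: measurable_cell|exact: null].
move=> y /= hy; have [l [u [ly yu lty lu]]] := HK (ev_of y).
have HFG z : orthant (gridv u) z -> ev_le (gridv l) (ev_of z) ->
    `|h z - h y| <= 2 * e.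
  move=> zu lz.
  have FF : `|df muF (gridv l) - df muF (gridv u)| < e.
    by apply: HF => j; apply: lt_le_trans (lu j) _; rewrite ge_min lexx.
  have GG : `|df muG (gridv l) - df muG (gridv u)| < e.
    by apply: HG => j; apply: lt_le_trans (lu j) _; rewrite ge_min lexx orbT.
  move: FF GG; rewrite !ltr_norml ler_norml /h.
  have := df_le muF ly; have := df_le muF yu; have := df_le muF lz.
  have := df_le muF zu; have := df_le muG ly; have := df_le muG yu.
  have := df_le muG lz; have := df_le muG zu; lra.
(* The coordinates of y are real, hence not -oo, which makes the lower bracket strict. *)
have Cy : cell (gridv l) (enum 'I_m) (gridv u) y.
  split; first exact: yu.
  by move=> j _; have := lty j; rewrite mxE; apply.
rewrite (bigD1 (l, u))/=; first by left.
apply/asboolP => z [zu lz].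
have lz' : ev_le (gridv l) (ev_of z).
  by apply/ev_leP => j; rewrite [leRHS]mxE ltW// lz// mem_enum.
have := HFG z zu lz'; have := ler_normB (h z) (h z - h y).
rewrite opprB addrCA subrr addr0.
lra.
Qed.

End cells.

(** * Consistency of the two tests *)

Section consistency.
Context (R : realType) (d : measure_display) (Omega : measurableType d)
  (P : probability Omega R) (m : nat) (X : nat -> {RV P >-> m.-tuple R}).
Variables (nu : nat -> probability (m.-tuple R) R).
Variables (S U : forall n : nat, n.-tuple (m.-tuple R) -> R) (s : nat -> R).
Variables (alpha c : R).

(** Once the null tail is at most alpha, the critical value is at most s_n c; failing to reject then
    forces U_n <= c, an event of vanishing probability. *)
Lemma rejection_probability_cvg1 :
  alpha < 1 -> (forall n, 0 <= s n) ->
  (forall n xs, @S n xs = s n * @U n xs) ->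
  (forall n, measurable_fun setT (@U n)) -> (forall n (xs : n.-tuple _), 0 <= @U n xs) ->
  (\forall n \near \oo,
    (iid_law (nu n) n [set xs | (c <= @U n xs)%R] <= alpha%:E)%E) ->
  (forall e : R, 0 < e -> \forall n \near \oo,
    (P [set w | (@U n [tuple X i w | i < n] <= c)%R] <= e%:E)%E) ->
  P [set w | quantile (iid_law (nu n) n) (@S n) (1 - alpha) <=
             @S n [tuple X i w | i < n]]
    @[n --> \oo] --> (1%:E : \bar R).
Proof.
move=> alpha1 s0 SE mU U0 null alt.
have mX n : measurable_fun setT (fun w => [tuple X i w | i < n]).
  apply/measurable_fun_tnthP => i.
  rewrite (_ : _ \o _ = X i); first exact: measurable_funP.
  by apply/funext => w; rewrite /= tnth_mktuple.
have mUX n : measurable_fun setT (fun w => @U n [tuple X i w | i < n]).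
  exact: measurableT_comp (mU n) (mX n).
have mA n : measurable [set w | quantile (iid_law (nu n) n) (@S n) (1 - alpha) <=
             @S n [tuple X i w | i < n]].
  apply: measurable_ge; under eq_fun do rewrite SE.
  exact: measurable_funM.
apply: cvg_probability1 => // e e0; near=> n.
have crit : quantile (iid_law (nu n) n) (@S n) (1 - alpha) <= s n * c.
  apply: (@quantile_scale_le _ _ _ (iid_law (nu n) n) (@S n) (@U n) (s n) c alpha) => //.
    exact: mU.
  by near: n.
apply: (@le_trans _ _ (P [set w | (@U n [tuple X i w | i < n] <= c)%R])).
  apply: le_measure; rewrite ?inE; [exact: measurableC|exact: measurable_le|].
  move=> w /= /negP; rewrite -ltNge SE => /lt_le_trans /(_ crit) h.
  rewrite leNgt; apply/negP => cU; move: h; apply/negP; rewrite -leNgt.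
  by rewrite ler_wpM2l// ltW.
by near: n; exact: alt.
Unshelve. all: by end_near. Qed.

End consistency.

Theorem corollary4 (R : realType) (d : measure_display) (Omega : measurableType d)
    (P : probability Omega R) (m : nat) (hm : (0 < m)%N)
    (X : nat -> {RV P >-> m.-tuple R})
    (hX : mutually_independent X)
    (muF : probability (m.-tuple R) R)
    (hFcont : unif_continuous (df muF))
    (hF : {uniform, (fun i => df (distribution P (X i))) @ \oo --> df muF})
    (nu : nat -> probability (m.-tuple R) R) (muG : probability (m.-tuple R) R)
    (hGcont : unif_continuous (df muG))
    (hG : {uniform, (fun n => df (nu n)) @ \oo --> df muG})
    (a : forall n : nat, 'I_n -> R)
    (ha_ge0 : forall (n : nat) (i : 'I_n), 0 <= a n i)
    (ha_sum : forall n : nat, (0 < n)%N -> \sum_(i < n) a n i = 1)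
    (ha_max : Num.sqrt n%:R * (\big[Num.max/0]_(i < n) a n i) @[n --> \oo] --> (0 : R))
    (kappa : R) (hkappa : 1 <= kappa)
    (ha_kappa : n%:R * (\sum_(i < n) a n i ^+ 2) @[n --> \oo] --> kappa)
    (alpha : R) (halpha : 0 < alpha < 1) :
  (~ (forall x : 'rV[\bar R]_m, df muF x - df muG x = 0) ->
     P [set w | KS_crit (a n) (nu n) alpha <=
                KS (a n) (df (nu n)) [tuple X i w | i < n]]
       @[n --> \oo] --> (1%:E : \bar R)) /\
  (~ {ae muG, forall y : m.-tuple R, df muF (ev_of y) - df muG (ev_of y) = 0} ->
     P [set w | CvM_crit (a n) (nu n) alpha <=
                CvM (a n) (nu n) [tuple X i w | i < n]]
       @[n --> \oo] --> (1%:E : \bar R)).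
Proof.
have mXs n := mutually_independent_sample n hX.
have mcomp n (U : n.-tuple (m.-tuple R) -> R) : measurable_fun setT U ->
    measurable_fun setT (fun w => U [tuple X i w | i < n]).
  by move=> mU; exact: measurableT_comp mU (measurable_sample (mXs n)).
have sq0 := sum_sqr_weights_cvg0 ha_kappa.
have mean_cvg := mean_df_cvg ha_ge0 ha_sum hF (max_weight_cvg0 ha_max).
have small (e : R) : 0 < e -> \forall n \near \oo, \sum_(i < n) a n i ^+ 2 < e.
  move=> e0; have /cvgrPdist_lt/(_ _ e0) := sq0; apply: filterS => n.
  by rewrite sub0r normrN => /(le_lt_trans (ler_norm _)).
have smallM (c e : R) : 0 < e -> 0 <= c -> \forall n \near \oo,
    c * (\sum_(i < n) a n i ^+ 2) <= e.
  move=> e0 c0; have c1 : 0 < c + 1 by lra.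
  near=> n; have : \sum_(i < n) a n i ^+ 2 < e / (c + 1).
    by near: n; apply: small; rewrite divr_gt0.
  rewrite ltr_pdivlMr// => h; apply: le_trans (ltW h).
  rewrite mulrC ler_wpM2l ?lerDl// sumr_ge0// => i _; exact: sqr_ge0.
have /andP[alpha0 alpha1] := halpha.
split=> [|nae].
  move=> /existsNP[x /eqP]; rewrite -normr_gt0.
  set eta := `|_| => eta0.
  (* With e = eta/20 the threshold 5e of [KSdist_tail] equals eta/4. *)
  have e0 : 0 < eta / 20 by lra.
  have [N HN] := KSdist_tail hGcont e0.
  have q0 : 0 < (eta / 4) ^+ 2 by rewrite exprn_gt0//; lra.
  apply: (@rejection_probability_cvg1 R d Omega P m X nu
    (fun n => KS (a n) (df (nu n))) (fun n => KSdist (a n) (df (nu n)))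
    (fun n => Num.sqrt n%:R) alpha (5 * (eta / 20))) => //.
  - by move=> n; exact: measurable_KSdist.
  - by move=> n xs; exact: KSdist_ge0.
  - near=> n; have n0 : (0 < n)%N by near: n; exact: nbhs_infty_gt.
    apply: le_trans (HN n (a n) (nu n) _ _ _) _ => //; first exact: ha_sum.
      by near: n; exact: df_uniform_cvg hG _ e0.
    rewrite lee_fin mulrAC; near: n; apply: smallM => //.
    by rewrite divr_ge0// sqr_ge0.
  - move=> e e'0; near=> n.
    have F8 : `|mean_df (a n) (fun i => distribution P (X i)) x - df muF x| < eta / 8.
      near: n; apply: filterS (mean_cvg (eta / 8) _); last lra.
      by move=> n; exact.
    have G8 : `|df (nu n) x - df muG x| < eta / 8.
      near: n; apply: filterS (df_uniform_cvg hG (e := eta / 8) _); last lra.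
      by move=> n; exact.
    pose D w := (wedf (a n) [tuple X i w | i < n] x -
      mean_df (a n) (fun i => distribution P (X i)) x) ^+ 2.
    have mW : measurable_fun setT (fun w => wedf (a n) [tuple X i w | i < n] x).
      by apply: (mcomp n (fun xs => wedf (a n) xs x)); exact: measurable_wedf.
    have mD : measurable_fun setT D.
      by apply: measurable_funX; exact: measurable_funB.
    have mK : measurable_fun setT
        (fun w => KSdist (a n) (df (nu n)) [tuple X i w | i < n]).
      by apply: (mcomp n (KSdist (a n) (df (nu n)))); exact: measurable_KSdist.
    (* At x, F and G are eta apart. A distance at most eta/4 and the two errors of eta/8 leave at
       least eta/2 for the deviation from the mean, more than the eta/4 asked for. *)
    apply: (@le_trans _ _ (P [set w | ((eta / 4) ^+ 2 <= D w)%R])).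
      apply: le_measure; rewrite ?inE; [exact: measurable_le|exact: measurable_ge|].
      move=> w /= Kw.
      have Wv := le_trans (KSdist_ge (ha_ge0 n) (nu n) [tuple X i w | i < n] x) Kw.
      rewrite /D -[leRHS]real_normK ?num_real// lerXn2r ?nnegrE//; first lra.
      move: Wv F8 G8 (eta0); rewrite /eta.
      set f := df muF x; set g := df muG x; set v := df _ x; set M := mean_df _ _ _.
      set W := wedf _ _ _; rewrite !ltr_norml.
      rewrite ler_norml.
      by case: (ger0P (f - g)) => fg; case: (ger0P (W - M)) => WM; lra.
    apply: le_trans (markov_bound mD _ (wedf_second_moment (mXs n) (a n) x) q0) _.
      by move=> w; exact: sqr_ge0.
    rewrite lee_fin mulrC; near: n; apply: smallM => //.
    by rewrite invr_ge0 ltW.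
have [l [x [eta [eta0 C0 HC]]]] := exists_charged_cell hFcont hGcont nae.
set C := cell _ _ _ in C0 HC; set p := fine _ in C0.
have mC : measurable C by exact: measurable_cell.
(* [CvMdist_lower] will be used with gap eta/2 and a measure of [C] above p/2, giving eta^2 p / 16.
   If the statistic takes at most eta^2 p / 64 of this, at least as much remains for the deviation
   from the mean. *)
have c0 : 0 < eta ^+ 2 * p / 64 by rewrite divr_gt0// mulr_gt0// exprn_gt0.
have nuC : fine (nu n C) @[n --> \oo] --> p.
  apply: cell_cvg => z; apply/cvgrPdist_lt => e e0.
  apply: filterS (df_uniform_cvg hG e0) => n /(_ z).
  by rewrite distrC.
have Gbound n : forall y, 0 <= df (nu n) (ev_of y) <= \sum_(i < n) a n i + 1.
  by move=> y; rewrite df_ge0/= (le_trans (df_le1 _ _))// lerDr sumr_ge0.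
apply: (@rejection_probability_cvg1 R d Omega P m X nu
    (fun n => CvM (a n) (nu n))
    (fun n => CvMdist (a n) (nu n) (fun y => df (nu n) (ev_of y)))
    (fun n => n%:R) alpha (eta ^+ 2 * p / 64)) => //.
- by move=> n; apply: measurable_CvMdist => //; exact: measurable_df_ev.
- by move=> n xs; exact: CvMdist_ge0.
- near=> n; have n0 : (0 < n)%N by near: n; exact: nbhs_infty_gt.
  have := CvMdist_tail (ha_ge0 n) (nu n) (iid_law_sample n (nu n)) c0.
  rewrite sample_tnth.
  (* Under the null all laws are [nu n] and the weights sum to one, so the mean is [df (nu n)]. *)
  rewrite (_ : (fun y => mean_df _ _ _) = (fun y => df (nu n) (ev_of y))); last first.
    by apply/funext => y; rewrite /mean_df -mulr_suml ha_sum// mul1r.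
  move=> /le_trans; apply; rewrite lee_fin mulrC; near: n; apply: smallM => //.
  by rewrite invr_ge0 ltW.
- move=> e e0; near=> n.
  have F4 y : `|mean_df (a n) (fun i => distribution P (X i)) y - df muF y| < eta / 4.
    by move: y; near: n; apply: mean_cvg; lra.
  have G4 y : `|df (nu n) y - df muG y| < eta / 4.
    by move: y; near: n; apply: (df_uniform_cvg hG (e := eta / 4)); lra.
  have Cn : p / 2 < fine (nu n C).
    have : `|p - fine (nu n C)| < p / 2.
      by near: n; move/cvgrPdist_lt: nuC; apply; rewrite divr_gt0.
    by rewrite ltr_norml; lra.
  pose V w := CvMdist (a n) (nu n) (fun y => mean_df (a n)
    (fun i : 'I_n => distribution P (X i)) (ev_of y)) [tuple X i w | i < n].
  have mV : measurable_fun setT V.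
    apply: (mcomp n (CvMdist (a n) (nu n) _)).
    apply: measurable_CvMdist => //; first exact: measurable_mean_df_ev.
    exact: mean_df_ev_bound.
  have mU : measurable_fun setT (fun w => CvMdist (a n) (nu n)
      (fun y => df (nu n) (ev_of y)) [tuple X i w | i < n]).
    apply: (mcomp n (CvMdist (a n) (nu n) _)).
    by apply: measurable_CvMdist => //; exact: measurable_df_ev.
  apply: le_trans (le_trans (CvMdist_tail (ha_ge0 n) (nu n) (mXs n) c0) _).
    apply: le_measure; rewrite ?inE; [exact: measurable_le|exact: (measurable_ge _ mV)|].
    move=> w /= Uw.
    have eta2 : 0 <= eta / 2 by lra.
    (* The gap eta on [C] loses at most eta/4 in passing from F to the mean and eta/4 from G to
       G_n. *)
    have HC' y : C y -> eta / 2 <=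
        `|mean_df (a n) (fun i => distribution P (X i)) (ev_of y) -
          df (nu n) (ev_of y)|.
      move=> /HC; have := F4 (ev_of y); have := G4 (ev_of y).
      set f := df muF _; set g := df muG _; set v := df _ _; set M := mean_df _ _ _.
      rewrite !ltr_norml => *; have := ler_normD (M - v) (f - g - (M - v)).
      rewrite [X in `|X| <= _]addrC subrK.
      have : `|f - g - (M - v)| <= eta / 2 by rewrite ler_norml; lra.
      lra.
    have := CvMdist_lower (ha_ge0 n) [tuple X i w | i < n] eta2 mC HC'.
    have : eta ^+ 2 * (p / 2) <= eta ^+ 2 * fine (nu n C).
      by rewrite ler_wpM2l ?sqr_ge0// ltW.
    rewrite /V expr_div_n; move: Uw; lra.
  rewrite lee_fin mulrC; near: n; apply: smallM => //.
  by rewrite invr_ge0 ltW.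
Unshelve. all: by end_near. Qed.
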